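(* Let $I$ be a set and let $\tau\colon\mathbb{R}^I\to\mathbb{R}$ be a function. The following conditions are equivalent. (1) $\tau$ preserves $\infty$-integrability. (2) $\tau$ preserves measurability and boundedness. (3) $\tau$ is $\mathrm{Cyl}(\mathbb{R}^I)$-measurable and, for every family $(M_i)_{i\in I}$ of nonnegative real numbers, the restriction of $\tau$ to $\prod_{i\in I}[-M_i,M_i]$ is bounded.
   Context: $\mathrm{Cyl}(\mathbb{R}^I)$ is the smallest $\sigma$-algebra on $\mathbb{R}^I$ making every projection $\pi_i\colon\mathbb{R}^I\to\mathbb{R}$ measurable; $\mathbb{R}$ carries its Borel $\sigma$-algebra. For a family $(f_i)_{i\in I}$ of functions $\Omega\to\mathbb{R}$, $\tau((f_i)_{i\in I})$ denotes the function $x\mapsto\tau((f_i(x))_{i\in I})$. For a measure space $(\Omega,\mathcal{F},\mu)$, $\mathcal{L}^\infty(\mu)$ is the set of $\mathcal{F}$-measurable functions $\Omega\to\mathbb{R}$ that are bounded outside of a measurable set of $\mu$-measure zero. - $\tau$ preserves $\infty$-integrability if for every measure space $(\Omega,\mathcal{F},\mu)$ and every family $(f_i)_{i\in I}$ in $\mathcal{L}^\infty(\mu)$, $\tau((f_i)_{i\in I})\in\mathcal{L}^\infty(\mu)$. - $\tau$ preserves measurability if for every measurable space $(\Omega,\mathcal{F})$ and every family $(f_i)_{i\in I}$ of $\mathcal{F}$-measurable functions $\Omega\to\mathbb{R}$, $\tau((f_i)_{i\in I})$ is $\mathcal{F}$-measurable. - $\tau$ preserves boundedness if for every set $\Omega$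 and every family $(f_i)_{i\in I}$ of bounded functions $\Omega\to\mathbb{R}$, $\tau((f_i)_{i\in I})$ is bounded. *)

(* Defs.v *)
From HB Require Import structures.
From mathcomp Require Import all_boot all_order all_algebra.
From mathcomp Require Import all_classical all_reals all_analysis.

Set Implicit Arguments.
Unset Strict Implicit.
Unset Printing Implicit Defensive.

Import Order.TTheory GRing.Theory Num.Theory.
Import numFieldNormedType.Exports.

Local Open Scope classical_set_scope.
Local Open Scope ring_scope.

Definition proj (R : realType) (I : Type) (i : I) : (I -> R) -> R :=
  fun x => x i.

(* A sigma-algebra on I -> R makes every projection measurable iff it contains
   this system, so the cylinder sigma-algebra is the one generated by it. *)
Definition cylinders (R : realType) (I : Type) : set (set (I -> R)) :=
  \bigcup_(i in [set: I])
    preimage_set_system [set: I -> R] (@proj R I i) (@measurable _ R).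

Definition Cyl (R : realType) (I : Type) :=
  g_sigma_algebraType (@cylinders R I).

Definition Linfty (R : realType) (d : measure_display)
    (Omega : measurableType d) (mu : {measure set Omega -> \bar R}) :
    set (Omega -> R) :=
  [set f : Omega -> R | measurable_fun [set: Omega] f /\
    exists N : set Omega,
      [/\ measurable N, mu N = 0%E & [bounded f x | x in ~` N]]].

Definition apply_family (R : realType) (I : Type) (tau : (I -> R) -> R)
    (Omega : Type) (f : I -> Omega -> R) : Omega -> R :=
  fun x => tau (fun i => f i x).

(* A measurableType is nonempty.  Excluding the empty space changes neither of
   the next two notions: every function on it is measurable and bounded. *)
Definition preserves_infty_integrability (R : realType) (I : Type)
    (tau : (I -> R) -> R) : Prop :=
  forall (d : measure_display) (Omega : measurableType d)
    (mu : {measure set Omega -> \bar R}) (f : I -> Omega -> R),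
  (forall i, Linfty mu (f i)) -> Linfty mu (apply_family tau f).

Definition preserves_measurability (R : realType) (I : Type)
    (tau : (I -> R) -> R) : Prop :=
  forall (d : measure_display) (Omega : measurableType d)
    (f : I -> Omega -> R),
  (forall i, measurable_fun [set: Omega] (f i)) ->
  measurable_fun [set: Omega] (apply_family tau f).

Definition preserves_boundedness (R : realType) (I : Type)
    (tau : (I -> R) -> R) : Prop :=
  forall (Omega : Type) (f : I -> Omega -> R),
  (forall i, [bounded f i x | x in [set: Omega]]) ->
  [bounded apply_family tau f x | x in [set: Omega]].

Definition box (R : realType) (I : Type) (M : I -> R) : set (I -> R) :=
  [set x | forall i, - M i <= x i <= M i].

(* Main.v *)
(* Every set of Cyl(R^I) is determined by countably many coordinates, hence so
   is a Cyl-measurable tau, by density of the rationals.  Given a family in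
   L^oo, one may thus replace all but countably many of its members by 0; the
   union of the remaining exceptional null sets is null, and off it the family
   takes its values in a box.  Conversely, the zero measure turns
   oo-integrability into measurability, the counting measure turns it into
   boundedness, and the projections from Cyl(R^I) and from the boxes are the
   universal measurable and bounded families. *)
Require Import Defs.
From HB Require Import structures.
From mathcomp Require Import all_boot all_order all_algebra.
From mathcomp Require Import all_classical all_reals all_analysis.

Import Order.TTheory GRing.Theory Num.Theory.
Import numFieldNormedType.Exports.

Local Open Scope classical_set_scope.
Local Open Scope ring_scope.

Lemma bounded_onP (R : realType) (T : Type) (f : T -> R) (A : set T) :
  [bounded f x | x in A] <-> exists M : R, forall x, A x -> `|f x| <= M.
Proof.
split=> [[M [_ fM]]|[M fM]].
  (* Boundedness is stated as a bound by every number strictly above [M], hence [M + 1]. *)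
  by exists (M + 1) => x Ax; apply: (fM (M + 1)) => //; rewrite ltrDl.
exists M; split; first exact: num_real.
by move=> y My x Ax; apply: le_trans (fM x Ax) (ltW My).
Qed.

Lemma measurable_fun_Cyl (R : realType) (I : Type) (d : measure_display)
    (Omega : measurableType d) (f : I -> Omega -> R) :
  (forall i, measurable_fun [set: Omega] (f i)) ->
  measurable_fun [set: Omega] (fun x => (fun i => f i x) : Cyl R I).
Proof.
move=> mf; apply: (@measurability _ _ Omega (Cyl R I) setT _ (@cylinders R I) erefl).
move=> _ [_ [i _ [B mB <-]] <-].
rewrite setTI preimage_setI preimage_setT setTI -[X in measurable X]setTI.
by apply: mf.
Qed.

Lemma measurable_proj (R : realType) (I : Type) (i : I) :
  measurable_fun [set: Cyl R I] (@Defs.proj R I i).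
Proof.
by move=> _ B mB; apply: sub_sigma_algebra; exists i => //; exists B.
Qed.

(** One implication suffices, since the condition on [x] and [y] is symmetric. *)
Definition determined_by {R : realType} {I : Type} (J : set I)
    (A : set (I -> R)) : Prop :=
  forall x y : I -> R, (forall i, J i -> x i = y i) -> A x -> A y.

(** The sets determined by countably many coordinates form a sigma-algebra, and each generator in
    [cylinders] depends on a single coordinate. *)
Lemma Cyl_determined (R : realType) (I : Type) (A : set (Cyl R I)) :
  measurable A -> exists2 J : set I, countable J & determined_by J A.
Proof.
pose C := [set A : set (I -> R) |
            exists2 J : set I, countable J & determined_by J A].
suff: <<s @cylinders R I >> `<=` C by apply.
apply: smallest_sub; last first.
  move=> _ [i _ [B _ <-]]; exists [set i]; first exact: countable1.
  by move=> x y xy [_ /= Bx]; split=> //=; rewrite /Defs.proj -(xy i).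
split.
- by exists set0; first exact: countable0.
- move=> B [J cJ BJ]; exists J => // x y xy [_ nBx]; split=> // By.
  by apply/nBx/(BJ y) => // i Ji; rewrite xy.
- move=> F CF.
  have /choice[J JP] (n : nat) :
      exists J : set I, countable J /\ determined_by J (F n).
    by have [J cJ FJ] := CF n; exists J.
  exists (\bigcup_n J n).
    by apply: bigcup_countable => // n _; have [] := JP n.
  move=> x y xy [n _ Fx]; exists n => //.
  have [_ FJ] := JP n.
  by apply: FJ Fx => i Ji; apply: xy; exists n.
Qed.

Lemma Cyl_measurable_fun_countable (R : realType) (I : Type)
    (tau : (I -> R) -> R) : measurable_fun [set: Cyl R I] tau ->
  exists2 J : set I, countable J & forall x y : I -> R,
    (forall i, J i -> x i = y i) -> tau x = tau y.
Proof.
move=> mtau.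
have CE (q : rat) : exists J : set I, countable J /\
    determined_by J (tau @^-1` `]-oo, (ratr q : R)[%classic).
  have [|J cJ JP] := @Cyl_determined R I (tau @^-1` `]-oo, (ratr q : R)[%classic).
    by rewrite -[X in measurable X]setTI; apply: mtau.
  by exists J.
have [J JP] := choice CE.
exists (\bigcup_q J q).
  by apply: bigcup_countable => // q _; have [] := JP q.
suff le x y : (forall i, (\bigcup_q J q) i -> x i = y i) -> tau x <= tau y.
  move=> x y xy; apply/eqP; rewrite eq_le !le// => i Ji; exact/esym/xy.
(* A rational [q] with [tau y < q < tau x] would put [y] but not [x] into a sublevel set determined
   by [J q]. *)
move=> xy; rewrite leNgt; apply/negP => /rat_in_itvoo[q].
rewrite in_itv/= => /andP[yq qx].
have [_ /(_ y x)] := JP q.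
move=> /(_ (fun i Ji => esym (xy i (ex_intro2 _ _ q Logic.I Ji)))) /=.
by rewrite !in_itv/= => /(_ yq) /lt_trans/(_ qx); rewrite ltxx.
Qed.

Lemma negligible_bigcup_countable (R : realFieldType) (I : Type)
    (d : measure_display) (T : measurableType d)
    (mu : {measure set T -> \bar R}) (J : set I) (N : I -> set T) :
  countable J -> (forall i, J i -> mu.-negligible (N i)) ->
  mu.-negligible (\bigcup_(i in J) N i).
Proof.
move=> /countable_injP[e einj] N0.
(* The injection [e] reindexes the union by [nat]; each fibre of [e] in [J] has at most one element,
   possibly none. *)
rewrite (_ : \bigcup_(i in J) N i =
    \bigcup_n \bigcup_(i in J `&` e @^-1` [set n]) N i); last first.
  apply/seteqP; split=> [x [i Ji Nx]|x [n _ [i [Ji _] Nx]]]; last by exists i.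
  by exists (e i) => //; exists i.
apply: negligible_bigcup => n.
have [[i [Ji ein]]|nJ] := pselect (exists i, J i /\ e i = n).
  apply: negligibleS (N0 i Ji) => x [j [Jj /= ejn] Nx].
  by rewrite (einj i j) ?inE// ein ejn.
apply: negligibleS (negligible_set0 mu) => x [i [Ji ein] _].
by apply: nJ; exists i.
Qed.

Lemma counting_eq0 (T : choiceType) (R : realType) (A : set T) :
  counting A = 0%E :> \bar R -> A = set0.
Proof.
rewrite /counting; case: ifPn => // /asboolP finA [] /eqP.
rewrite pnatr_eq0 finmap.cardfs_eq0 => /eqP A0.
by rewrite -(fset_setK finA) A0 set_fset0.
Qed.

Lemma infty_integrability_measurability (R : realType) (I : Type)
    (tau : (I -> R) -> R) :
  preserves_infty_integrability tau -> preserves_measurability tau.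
Proof.
move=> tau1 d Omega f mf.
have [] // := tau1 d Omega mzero f.
(* The whole space is null for [mzero], and boundedness on its empty complement is vacuous. *)
move=> i; split=> //; exists setT; split=> //.
by apply/bounded_onP; exists 0 => x; rewrite setCT.
Qed.

(* An unbounded value set already contains an unbounded sequence, so the
   counting measure on nat, whose only null set is empty, suffices. *)
Lemma infty_integrability_boundedness (R : realType) (I : Type)
    (tau : (I -> R) -> R) :
  preserves_infty_integrability tau -> preserves_boundedness tau.
Proof.
move=> tau1 Omega f bf; apply/bounded_onP; apply: contrapT => ub.
have /choice[s sP] (n : nat) : exists x, n%:R < `|apply_family tau f x|.
  apply: contrapT => nx; apply: ub; exists n%:R => x _.
  by rewrite leNgt; apply/negP => nx'; apply: nx; exists x.
have [|_ [N [_ /counting_eq0 ->]]] :=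
    tau1 _ nat (counting (R := R)) (fun i n => f i (s n)).
  move=> i; split=> //; exists set0; split=> //.
  have /bounded_onP[M fM] := bf i.
  by apply/bounded_onP; exists M => n _; apply: fM.
rewrite setC0 => /bounded_onP[M tM].
have := sP (Num.bound `|M|); rewrite ltNge => /negP; apply.
apply: le_trans (tM _ _) _ => //.
by apply: ltW; apply: le_lt_trans (ler_norm _) (archi_boundP (normr_ge0 _)).
Qed.

Lemma Cyl_preserves_infty_integrability (R : realType) (I : Type)
    (tau : (I -> R) -> R) :
  measurable_fun [set: Cyl R I] tau ->
  (forall M : I -> R, (forall i, 0 <= M i) -> [bounded tau x | x in box M]) ->
  preserves_infty_integrability tau.
Proof.
move=> mtau btau d Omega mu f Lf; split.
  apply: (measurableT_comp mtau).
  by apply: measurable_fun_Cyl => i; have [] := Lf i.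
have [J cJ tauJ] := Cyl_measurable_fun_countable _ _ _ mtau.
have /choice[N NP] (i : I) : exists N, mu.-negligible N /\
    exists M : R, forall x, ~ N x -> `|f i x| <= M.
  have [_ [N [mN N0 /bounded_onP bN]]] := Lf i.
  by exists N; split; [exact/negligibleP|exact: bN].
have /choice[M MP] (i : I) : exists M : R, forall x, ~ N i x -> `|f i x| <= M.
  by have [] := NP i.
have [|N' [mN' N'0 subN']] := negligible_bigcup_countable _ _ _ _ mu J N cJ.
  by move=> i _; have [] := NP i.
exists N'; split=> //.
(* Nothing forces [M i] to be nonnegative, hence the absolute values. *)
have /bounded_onP[K tK] := btau (fun i => `|M i|) (fun i => normr_ge0 _).
apply/bounded_onP; exists K => x nN'x; rewrite /apply_family.
(* For [i] outside [J] the point [x] may lie in [N i]; setting these coordinates to [0] keeps the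
   family in the box and does not change [tau]. *)
rewrite (tauJ _ (fun i => if `[< J i >] then f i x else 0)); last first.
  by move=> i Ji; case: asboolP.
apply: tK => i; rewrite -ler_norml; case: asboolP => [Ji|_]; last first.
  by rewrite normr0.
apply: le_trans (ler_norm _); apply: MP => Nx.
by apply: nN'x; apply: subN'; exists i.
Qed.

Lemma Cyl_preserves_measurability (R : realType) (I : Type)
    (tau : (I -> R) -> R) :
  measurable_fun [set: Cyl R I] tau <-> preserves_measurability tau.
Proof.
split=> [mtau d Omega f mf|].
  by apply: (measurableT_comp mtau); apply: measurable_fun_Cyl.
(* For the family of all projections, [apply_family tau] is [tau] itself. *)
by move=> /(_ _ (Cyl R I) (@Defs.proj R I)); apply=> i; apply: measurable_proj.
Qed.

Lemma box_preserves_boundedness (R : realType) (I : Type)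
    (tau : (I -> R) -> R) :
  (forall M : I -> R, (forall i, 0 <= M i) -> [bounded tau x | x in box M]) <->
  preserves_boundedness tau.
Proof.
split=> [btau Omega f bf|btau M M0].
  have /choice[M fM] (i : I) : exists M : R, forall x, `|f i x| <= M.
    by have /bounded_onP[M fM] := bf i; exists M => x; apply: fM.
  have /bounded_onP[K tK] := btau (fun i => `|M i|) (fun i => normr_ge0 _).
  apply/bounded_onP; exists K => x _; apply: tK => i.
  by rewrite -ler_norml; apply: le_trans (ler_norm _).
(* The coordinates are bounded functions on the box taken as a type, and [tau] applied to them is
   its restriction to the box. *)
have [|K tK] := (bounded_onP _ _ _ _).1
    (btau {x | box M x} (fun i u => sval u i) _).
  by move=> i; apply/bounded_onP; exists (M i) => -[x bx] _; rewrite ler_norml.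
by apply/bounded_onP; exists K => x bx; apply: (tK (exist _ x bx)).
Qed.

Theorem theoremA5 (R : realType) (I : Type) (tau : (I -> R) -> R) :
  (preserves_infty_integrability tau <->
     preserves_measurability tau /\ preserves_boundedness tau) /\
  (preserves_measurability tau /\ preserves_boundedness tau <->
     measurable_fun [set: Cyl R I] tau /\
     (forall M : I -> R, (forall i, 0 <= M i) ->
        [bounded tau x | x in box M])).
Proof.
(* After this rewriting the two sides of the second equivalence coincide. *)
rewrite Cyl_preserves_measurability box_preserves_boundedness; split=> //.
split=> [tau1|[mtau btau]].
  split; first exact: infty_integrability_measurability.
  exact: infty_integrability_boundedness.
apply: Cyl_preserves_infty_integrability.
  exact/Cyl_preserves_measurability.
exact/box_preserves_boundedness.
Qed.
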